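(* Let $A$ be a commutative ring, $E$ a non-zero $A$-module and $R=A\propto E$ the trivial ring extension of $A$ by $E$. Assume that $\mathrm{pSpec}(A)$ is totally disconnected. The following are equivalent: (1) $R$ is Hermite; (2) $R$ is B\'ezout; (3) $A$ is B\'ezout, $A_P$ is a domain for each $P\in\mathrm{Supp}(E)$, $E$ is locally FP-injective and all finitely generated submodules of $E$ are cyclic.
   Context: All rings are commutative with identity. The trivial ring extension $R=A\propto E$ is the ring with underlying group $A\times E$ and multiplication $(a,e)(a',e')=(aa',ae'+a'e)$. On $\mathrm{Spec}(A)$ (Zariski topology) let $\mathcal R$ be the equivalence relation where $L\mathcal R L'$ iff there is a finite chain of primes $L=L_1,\dots,L_n=L'$ with, for each $k$, $L_k\subseteq L_{k+1}$ or $L_k\supseteq L_{k+1}$; $\mathrm{pSpec}(A)$ is the quotient space $\mathrm{Spec}(A)/\mathcal R$. A space is totally disconnected if each connected component is a single point. A ring is B\'ezout if every finitely generated ideal is principal; $R$ is Hermite if for all $a,b\in R$ there exist $d,a',b'$ with $a=da'$, $b=db'$, $Ra'+Rb'=R$. A module is FP-injective if $\mathrm{Ext}^1(F,E)=0$ for all finitely presented $F$; locally FP-injective if $E_P$ is FP-injective over $A_P$ for each maximal ideal $P$. $\mathrm{Supp}(E)=\{P \text{ prime}: E_P\neq 0\}$. *)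

(* Defs.v *)
From HB Require Import structures.
From mathcomp Require Import all_boot all_order all_algebra.
From mathcomp Require Import generic_quotient all_classical topology.
From Stdlib Require Import Relation_Operators.
Set Implicit Arguments. Unset Strict Implicit. Unset Printing Implicit Defensive.
Import GRing.Theory.
Local Open Scope ring_scope.
Local Open Scope classical_set_scope.

Section TrivExt.
Variables (A : comNzRingType) (E : lmodType A).
Definition triv_ext : Type := (A * E)%type.
HB.instance Definition _ := GRing.Zmodule.on triv_ext.
Definition te_one : triv_ext := (1, 0).
Definition te_mul (x y : triv_ext) : triv_ext :=
  (x.1 * y.1, x.1 *: y.2 + y.1 *: x.2).
Lemma te_mulA : associative te_mul.
Proof.
case=> a e [b f] [c g]; rewrite /te_mul /=; congr pair; first by rewrite mulrA.
rewrite !scalerDr !scalerA addrA; congr (_ + _ + _);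
  by rewrite ?(mulrC c) ?mulrA ?(mulrC b).
Qed.
Lemma te_mulC : commutative te_mul.
Proof. by case=> a e [b f]; rewrite /te_mul /= mulrC addrC. Qed.
Lemma te_mul1 : left_id te_one te_mul.
Proof. by case=> a e; rewrite /te_mul /= mul1r scale1r scaler0 addr0. Qed.
Lemma te_mulDl : left_distributive te_mul +%R.
Proof.
case=> a e [b f] [c g]; rewrite /te_mul /=; congr pair; first by rewrite mulrDl.
by rewrite scalerDl scalerDr addrACA.
Qed.
Lemma te_one_neq0 : te_one != 0.
Proof. by apply/negP => /eqP [] /eqP; rewrite oner_eq0. Qed.
HB.instance Definition _ := GRing.Zmodule_isComNzRing.Build triv_ext
  te_mulA te_mulC te_mul1 te_mulDl te_one_neq0.
End TrivExt.

Section Ideals.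
Variable R : comNzRingType.

Definition fg_ideal (m : nat) (g : 'I_m -> R) : set R :=
  [set x | exists c : 'I_m -> R, x = \sum_(i < m) c i * g i].

Definition principal_ideal (d : R) : set R := [set x | exists r : R, x = r * d].

Definition bezout_ring : Prop :=
  forall (m : nat) (g : 'I_m -> R), exists d : R, fg_ideal g = principal_ideal d.

Definition hermite_ring : Prop :=
  forall a b : R, exists d a' b' : R,
    [/\ a = d * a', b = d * b' &
        [set x | exists u v : R, x = u * a' + v * b'] = [set: R]].

Definition is_ideal (I : set R) : Prop :=
  [/\ I 0, (forall x y, I x -> I y -> I (x + y)) & (forall r x, I x -> I (r * x))].

Definition prime_ideal (P : set R) : Prop :=
  [/\ is_ideal P, ~ P 1 & forall x y, P (x * y) -> P x \/ P y].

Definition maximal_ideal (P : set R) : Prop :=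
  [/\ is_ideal P, ~ P 1 &
      forall Q : set R, is_ideal Q -> ~ Q 1 -> P `<=` Q -> Q = P].

Definition is_domain : Prop := forall a b : R, a * b = 0 -> a = 0 \/ b = 0.
End Ideals.

Definition fg_submod (R : comNzRingType) (V : lmodType R) (m : nat)
    (v : 'I_m -> V) : set V :=
  [set x | exists c : 'I_m -> R, x = \sum_(i < m) c i *: v i].

Section Modules.
Variables (R : comNzRingType) (M : lmodType R).

Definition cyclic_submod (e : M) : set M := [set x | exists r : R, x = r *: e].

Definition fg_submodules_cyclic : Prop :=
  forall (m : nat) (v : 'I_m -> M), exists e : M, fg_submod v = cyclic_submod e.

(* FP-injective: Ext^1(F, M) = 0 for every finitely presented F, i.e. for   *)
(* every finitely generated submodule K of a free module R^n, every R-linear *)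
(* map K -> M extends to an R-linear map R^n -> M.            *)
Definition fp_injective : Prop :=
  forall (n m : nat) (g : 'I_m -> 'rV[R]_n) (f : 'rV[R]_n -> M),
    (forall x y, fg_submod g x -> fg_submod g y -> f (x + y) = f x + f y) ->
    (forall (r : R) x, fg_submod g x -> f (r *: x) = r *: f x) ->
    exists h : {linear 'rV[R]_n -> M}, forall x, fg_submod g x -> h x = f x.
End Modules.

(* Localizations at a prime P (characterised as in Mathlib's                 *)
(* IsLocalization / IsLocalizedModule): B is "A_P" via phi, N is "E_P" via   *)
(* psi.                                                                      *)
Section Localization.
Variables (A : comNzRingType) (P : set A).

Definition is_localization_at (B : comNzRingType) (phi : {rmorphism A -> B}) : Prop :=
  [/\ (forall s, ~ P s -> exists t : B, phi s * t = 1),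
      (forall b : B, exists a s : A, ~ P s /\ b * phi s = phi a) &
      (forall a : A, phi a = 0 -> exists s : A, ~ P s /\ s * a = 0)].

Definition is_localized_module_at (E : lmodType A) (B : comNzRingType)
    (phi : {rmorphism A -> B}) (N : lmodType B) (psi : E -> N) : Prop :=
  [/\ (forall e e' : E, psi (e + e') = psi e + psi e'),
      (forall (a : A) (e : E), psi (a *: e) = phi a *: psi e),
      (forall n : N, exists (e : E) (s : A), ~ P s /\ phi s *: n = psi e) &
      (forall e : E, psi e = 0 -> exists s : A, ~ P s /\ s *: e = 0)].
End Localization.

Section LocalProps.
Variables (A : comNzRingType) (E : lmodType A).

Definition domain_on_support : Prop :=
  forall P : set A, prime_ideal P ->
  forall (B : comNzRingType) (phi : {rmorphism A -> B})
         (N : lmodType B) (psi : E -> N),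
    is_localization_at P phi -> is_localized_module_at P phi psi ->
    (exists n : N, n != 0) -> is_domain B.

Definition locally_fp_injective : Prop :=
  forall P : set A, maximal_ideal P ->
  forall (B : comNzRingType) (phi : {rmorphism A -> B})
         (N : lmodType B) (psi : E -> N),
    is_localization_at P phi -> is_localized_module_at P phi psi ->
    fp_injective N.
End LocalProps.

Section Spec.
Variable A : comNzRingType.

Record spec : Type := Spec { spec_ideal :> set A; spec_prime : prime_ideal spec_ideal }.
HB.instance Definition _ := gen_eqMixin spec.
HB.instance Definition _ := gen_choiceMixin spec.

Definition zariski_basic (i : option A) : set spec :=
  if i is Some f then [set L : spec | ~ spec_ideal L f] else set0.
HB.instance Definition _ :=
  @isSubBaseTopological.Build spec (option A) (range Some) zariski_basic.

(* L R L' iff there is a finite chain L = L_1, ..., L_n = L' with          *)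
(* consecutive members comparable for inclusion: the equivalence closure    *)
(* of inclusion.                                                            *)
Definition spec_incl (L L' : spec) : Prop := (L : set A) `<=` L'.
Definition pspec_rel (L L' : spec) : bool :=
  `[< clos_refl_sym_trans spec spec_incl L L' >].

Lemma pspec_rel_refl : reflexive pspec_rel.
Proof. by move=> L; apply/asboolP; apply: rst_refl. Qed.
Lemma pspec_rel_sym : symmetric pspec_rel.
Proof.
by move=> L L'; apply/asboolP/asboolP; apply: rst_sym.
Qed.
Lemma pspec_rel_trans : transitive pspec_rel.
Proof.
by move=> L2 L1 L3 /asboolP h12 /asboolP h23; apply/asboolP; apply: rst_trans h23.
Qed.
Canonical pspec_equiv :=
  EquivRel pspec_rel pspec_rel_refl pspec_rel_sym pspec_rel_trans.

Definition pSpec : Type := quotient_topology {eq_quot pspec_rel}%qT.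
End Spec.

(* Main.v *)
(** For a Bezout ring [A] with totally disconnected pSpec, [a b = 0] implies that
    some idempotent [e] makes both [e a] and [(1 - e) b] nilpotent: two primes
    containing the same idempotents lie in a connected closed subset of Spec, so
    they are related and, the primes below a given one forming a chain, share a
    smaller prime. This splitting property replaces passing to the stalks over
    pSpec. It makes a Bezout ring Hermite, and it lifts from [A] to the trivial
    extension [R], whence (2) implies (1) and [A] is Hermite under (3).

    (2) => (3): locally at a prime, [(a, 0)] and [(0, e)] are comparable for
    divisibility in [R]; so every [a] that is non-zero in [A_P] divides [E_P].
    Over a chain ring such a module is FP-injective, and if it is non-zero then
    [A_P] is a domain.

    (3) => (2): as [A] is Hermite, an ideal with two generators is generated by
    some [(d, e)] and [(0, f)]. An idempotent separates the part where [d]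
    divides [f] from the part where [d] is nilpotent; on the latter the
    annihilators of [d] and of [A e + A f] are comaximal. *)

Require Import Defs.
From HB Require Import structures.
From mathcomp Require Import all_boot all_order all_algebra.
From mathcomp Require Import generic_quotient all_classical topology.
From mathcomp Require Import finmap ring.
From Stdlib Require Import Relation_Operators.
Set Implicit Arguments. Unset Strict Implicit. Unset Printing Implicit Defensive.
Import GRing.Theory.
Local Open Scope ring_scope.
Local Open Scope classical_set_scope.

(** * Prime ideals *)

Section Primes.
Variable A : comNzRingType.
Implicit Types (I J P Q : set A) (a b c s : A).

Lemma is_idealB {I a b} : is_ideal I -> I a -> I b -> I (a - b).
Proof. by move=> [_ ID IM] Ia Ib; rewrite -mulN1r; apply: ID => //; apply: IM. Qed.

Lemma idemN {a} : a * a = a -> (1 - a) * (1 - a) = 1 - a.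
Proof. by move=> aa; transitivity (1 - 2 * a + a * a); [ring | rewrite aa; ring]. Qed.

Lemma idemU {a b} : a * a = a -> b * b = b ->
  (a + b - a * b) * (a + b - a * b) = a + b - a * b.
Proof.
move=> aa bb; transitivity (1 - (1 - a) * (1 - b)); last by ring.
transitivity (1 - 2 * ((1 - a) * (1 - b)) +
  ((1 - a) * (1 - a)) * ((1 - b) * (1 - b))); first by ring.
by rewrite !idemN //; ring.
Qed.

Lemma ideal_linear_comb a b : is_ideal [set x | exists u v, x = u * a + v * b].
Proof.
split=> [|x y [u [v ->]] [u' [v' ->]]|r x [u [v ->]]].
- by exists 0, 0; ring.
- by exists (u + u'), (v + v'); ring.
- by exists (r * u), (r * v); ring.
Qed.

Lemma prime_ideal_expr P a n : prime_ideal P -> P (a ^+ n) -> P a.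
Proof.
move=> [_ P1 PM]; elim: n => [|n IHn]; first by rewrite expr0 => /P1.
by rewrite exprS => /PM [].
Qed.

Lemma prime_ideal_idemN {P e} : prime_ideal P -> e * e = e -> ~ P e -> P (1 - e).
Proof.
move=> [[P0 _ _] _ PM] ee Pe; suff /PM [] : P (e * (1 - e)) by [].
by rewrite mulrBr mulr1 ee subrr.
Qed.

Lemma prime_ideal_onem {P e} : prime_ideal P -> P e -> ~ P (1 - e).
Proof. by move=> [[_ PD _] P1 _] Pe P1e; apply: P1; rewrite -(subrK e 1); apply: (PD). Qed.

Lemma exists_ideal_maximal_disjoint I (S : set A) :
  is_ideal I -> (forall x, I x -> ~ S x) ->
  exists P, [/\ is_ideal P, I `<=` P, (forall x, P x -> ~ S x) &
    forall Q, is_ideal Q -> P `<=` Q -> (forall x, Q x -> ~ S x) -> Q = P].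
Proof.
move=> idI IS.
pose good J := [/\ is_ideal J, I `<=` J & forall x, J x -> ~ S x].
have [|P [PP maxP]] := @Zorn_bigcup A (fun J => J = set0 \/ good J).
  move=> F FP Ftot.
  have [[J [FJ [j Jj]]]|noF] := pselect (exists J, F J /\ exists j, J j); last first.
    left; apply/seteqP; split=> // x [J FJ Jx].
    by apply: noF; exists J; split=> //; exists x.
  have Fgood K k : F K -> K k -> good K.
    by move=> /FP [->|].
  have [[J0 JD JM] IJ JS] := Fgood _ _ FJ Jj.
  right; split; last by move=> x [K FK Kx]; have [_ _] := Fgood _ _ FK Kx; apply.
    split; first by exists J.
    - move=> x y [K FK Kx] [L FL Ly]; have [KL|LK] := Ftot _ _ FK FL.
        have [[_ LD _] _ _] := Fgood _ _ FL Ly.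
        by exists L => //; apply: LD => //; apply: KL.
      have [[_ KD _] _ _] := Fgood _ _ FK Kx.
      by exists K => //; apply: KD => //; apply: LK.
    - move=> r x [K FK Kx]; have [[_ _ KM] _ _] := Fgood _ _ FK Kx.
      by exists K => //; apply: KM.
  by move=> x Ix; exists J => //; apply: IJ.
case: PP => [P0|[idP IP PS]].
  exfalso; apply: (maxP I); last by right; split.
  by rewrite P0; split=> // /(_ 0); apply; case: idI.
exists P; split=> // Q idQ PQ QS; apply: contrapT => QP.
apply: (maxP Q); last by right; split=> //; apply: subset_trans PQ.
by split=> // QsP; apply: QP; apply/seteqP.
Qed.

(** If [x] and [y] lie outside a maximal such [P], both [P + (x)] and [P + (y)] meet [S]; the
    product of the two elements is in [S], and would be in [P] if [x * y] were. *)
Lemma exists_prime_disjoint I (S : set A) :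
  is_ideal I -> S 1 -> (forall x y, S x -> S y -> S (x * y)) ->
  (forall x, I x -> ~ S x) ->
  exists P, [/\ prime_ideal P, I `<=` P & forall x, P x -> ~ S x].
Proof.
move=> idI S1 SM IS.
have [P [[P0 PD PM] IP PS maxP]] := @exists_ideal_maximal_disjoint I S idI IS.
exists P; split=> //; split=> // [|x y Pxy]; first by move=> /PS.
have step z : ~ P z -> exists2 p, P p & exists r, S (p + r * z).
  move=> Pz; pose Q : set A := [set q | exists2 p, P p & exists r, q = p + r * z].
  apply: contrapT => H; apply: Pz; rewrite -(maxP Q).
  - by exists 0 => //; exists 1; rewrite add0r mul1r.
  - split; first by exists 0 => //; exists 0; rewrite mul0r addr0.
      move=> _ _ [p Pp [r ->]] [p' Pp' [r' ->]].
      by exists (p + p'); [apply: (PD) | exists (r + r'); ring].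
    move=> c _ [p Pp [r ->]]; exists (c * p); first exact: PM.
    by exists (c * r); ring.
  - by move=> p Pp; exists p => //; exists 0; rewrite mul0r addr0.
  - by move=> q [p Pp [r ->]] Sq; apply: H; exists p => //; exists r.
have [//|/step [p Pp [r Spr]]] := pselect (P x); first by left.
have [//|/step [q Pq [t Sqt]]] := pselect (P y); first by right.
exfalso; apply: (PS _ _ (SM _ _ Spr Sqt)).
have -> : (p + r * x) * (q + t * y) = (q + t * y) * p + (r * x * q + r * t * (x * y)) by ring.
by apply: (PD); [exact: PM | apply: (PD); exact: PM].
Qed.

Lemma maximal_ideal_prime P : maximal_ideal P -> prime_ideal P.
Proof.
move=> [idP P1 maxP].
have [] := @exists_prime_disjoint P [set 1] idP erefl.
- by move=> x y /= -> ->; rewrite mulr1.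
- by move=> x Px /= x1; apply: P1; rewrite -x1.
move=> Q [pQ PQ Q1]; rewrite -(maxP Q) //; first by case: pQ.
by move=> /Q1; apply.
Qed.

Lemma exists_maximal I : is_ideal I -> ~ I 1 ->
  exists P, maximal_ideal P /\ I `<=` P.
Proof.
move=> idI I1; have [|P [idP IP P1 maxP]] := @exists_ideal_maximal_disjoint I [set 1] idI.
  by move=> x Ix /= x1; apply: I1; rewrite -x1.
exists P; split=> //; split=> //; first by move=> /P1; apply.
by move=> Q idQ Q1 PQ; apply: maxP => // x Qx /= x1; apply: Q1; rewrite -x1.
Qed.

(** Local-to-global device: [I] will collect the scalars for which some equation is solvable, so
    solving it at each maximal ideal solves it for [1]. *)
Lemma ideal_unit_local I : is_ideal I ->
  (forall P, maximal_ideal P -> exists2 s, ~ P s & I s) -> I 1.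
Proof.
move=> idI loc; apply: contrapT => /(exists_maximal idI) [P [mP IP]].
by have [s Ps /IP] := loc P mP.
Qed.

Lemma exists_prime_avoiding I a : is_ideal I -> (forall n, ~ I (a ^+ n)) ->
  exists P, [/\ prime_ideal P, I `<=` P & ~ P a].
Proof.
move=> idI Ia; have [] := @exists_prime_disjoint I [set x | exists n, x = a ^+ n] idI.
- by exists 0; rewrite expr0.
- by move=> _ _ [n ->] [m ->]; exists (n + m); rewrite exprD.
- by move=> x Ix [n xE]; apply: (Ia n); rewrite -xE.
by move=> P [pP IP PS]; exists P; split=> // /PS; apply; exists 1; rewrite expr1.
Qed.

End Primes.

(** * Connected loci in the spectrum *)

Section Spectrum.
Variable A : comNzRingType.
Implicit Types (L M : spec A) (a b : A).

(** The product of the elements of a finite list gives one basic open set [D(f)] inside the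
    intersection of the subbasic ones. *)
Lemma zariski_basic_seq (s : seq (option A)) L :
  (forall i, i \in s -> zariski_basic i L) ->
  exists2 f, ~ (L : set A) f &
    forall M, ~ (M : set A) f -> forall i, i \in s -> zariski_basic i M.
Proof.
elim: s => [|i s IHs] sL; first by exists 1 => //; case: (spec_prime L).
have [|f Lf fs] := IHs; first by move=> j js; apply: sL; rewrite inE js orbT.
case: i sL => [g|] sL; last by have := sL None (mem_head _ _).
have Lg : ~ (L : set A) g by exact: (sL (Some g) (mem_head _ _)).
exists (f * g) => [|M Mfg j].
  by have [_ _ PM] := spec_prime L => /PM [].
have [[_ _ MM] _ _] := spec_prime M.
rewrite inE => /orP [/eqP -> /= Mg|js]; first by apply: Mfg; apply: MM.
by apply: fs => // Mf; apply: Mfg; rewrite mulrC; apply: MM.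
Qed.

Lemma open_spec_basic (U : set (spec A)) L : open U -> U L ->
  exists2 f, ~ (L : set A) f & forall M, ~ (M : set A) f -> U M.
Proof.
case=> D sD UE; rewrite -UE => -[V DV VL]; have := sD _ DV => /= -[F FD VE].
move: (VL); rewrite -{1}VE => /(@zariski_basic_seq (enum_fset F)) [f Lf fF].
exists f => // M Mf; exists V => //; rewrite -VE => i iF.
by apply: fF.
Qed.

(* The ideal generated by the idempotents of [L]: a sum of idempotent-generated
   principal ideals is again one, since [1 - (1 - e)(1 - e')] is idempotent. *)
Definition idem_ideal L : set A :=
  [set x | exists2 e, e * e = e & (L : set A) e /\ exists r, x = e * r].

Lemma idem_ideal_is_ideal L : is_ideal (idem_ideal L).
Proof.
have [idL L1 LM] := spec_prime L; have [L0 LD LZ] := idL.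
split=> [|x y [e ee [Le [r ->]]] [f ff [Lf [t ->]]]|c x [e ee [Le [r ->]]]].
- by exists 0; rewrite ?mulr0 //; split=> //; exists 0; rewrite mulr0.
- exists (e + f - e * f); first exact: idemU ee ff.
  split; first by exact: is_idealB idL (LD _ _ Le Lf) (LZ _ _ Lf).
  exists (e * r + f * t).
  transitivity (e * e * r + f * f * t + (e - e * e) * f * r + (f - f * f) * e * t).
    by rewrite ee ff; ring.
  by ring.
- by exists e => //; split=> //; exists (r * c); ring.
Qed.

Lemma idem_ideal_sub L : idem_ideal L `<=` L.
Proof.
have [[_ _ LZ] _ _] := spec_prime L.
by move=> _ [e _ [Le [r ->]]]; rewrite mulrC; apply: LZ.
Qed.

(** An idempotent outside [L] has its complement in [L], so these are the primes with exactly the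
    same idempotents as [L]. *)
Definition idem_locus L : set (spec A) := [set M | idem_ideal L `<=` M].

Lemma comax_expr a b n : a + b = 1 -> exists c, a * c + b ^+ n = 1.
Proof.
move=> ab; elim: n => [|n [c IHn]]; first by exists 0; rewrite mulr0 add0r.
exists (1 + b * c); rewrite exprS.
by transitivity (a + b * (a * c + b ^+ n)); [ring | rewrite IHn mulr1].
Qed.

(* A clopen splitting of the locus yields comaximal [u], [v] with [u v]
   nilpotent modulo [idem_ideal L]; this lifts to an idempotent of [A], which
   lies in [L] or has its complement in [L]. *)
Lemma idem_locus_connected L : connected (idem_locus L).
Proof.
move=> B [M0 BM0] [U oU BU] [F cF BF].
have idI := idem_ideal_is_ideal L; have [idL L1 LM] := spec_prime L.
pose small (W : set (spec A)) := [set f : A | forall M, idem_locus L M -> ~ (M : set A) f -> W M].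
have id_small W : is_ideal (small W).
  split=> [M _ []|f g fW gW M LMM Mfg|r f fW M LMM Mrf]; first by case: (spec_prime M) => -[].
  - have [Mf|Mf] := pselect ((M : set A) f); last exact: fW.
    apply: gW => // Mg; apply: Mfg; have [[_ MD _] _ _] := spec_prime M; exact: MD.
  - by apply: fW => // Mf; apply: Mrf; have [[_ _ MZ] _ _] := spec_prime M; apply: MZ.
have BFc M : idem_locus L M -> ~ B M -> (~` F) M.
  by move=> LMM BM FM; apply: BM; rewrite BF; split.
(* Otherwise a maximal ideal contains both ideals. Elements of [idem_ideal L] lie vacuously in
   [small B], so it is a point of the locus, and a basic neighbourhood of it inside [B] or inside
   the complement gives a contradiction. *)
have [f [g [fB gB fg1]]] : exists f g, [/\ small B f, small (~` B) g & f + g = 1].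
  pose S := [set x | exists f g, [/\ small B f, small (~` B) g & x = f + g]].
  have sBS : small B `<=` S.
    by move=> f fB; exists f, 0; rewrite addr0; split=> //; case: (id_small (~` B)).
  have sBcS : small (~` B) `<=` S.
    by move=> f fB; exists 0, f; rewrite add0r; split=> //; case: (id_small B).
  have idS : is_ideal S.
    have [B0 BD BM] := id_small B; have [C0 CD CM] := id_small (~` B).
    split; first exact: sBS.
    - move=> _ _ [f [g [fB gB ->]]] [f' [g' [fB' gB' ->]]].
      by exists (f + f'), (g + g'); split; [exact: BD | exact: CD | ring].
    - move=> r _ [f [g [fB gB ->]]]; exists (r * f), (r * g).
      by split; [exact: BM | exact: CM | ring].
  suff [f [g [fB gB /esym fg]]] : S 1 by exists f, g.
  apply: contrapT => /(exists_maximal idS) [P [mP SP]].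
  pose M := Spec (maximal_ideal_prime mP).
  have LMM : idem_locus L M.
    move=> x Ix; apply: SP; apply: sBS => N LN Nx; exfalso; apply: Nx; exact: LN.
  have [BM|BM] := pselect (B M).
    have UM : U M by move: BM; rewrite BU => -[].
    have [f Mf fU] := open_spec_basic oU UM.
    by apply: Mf; apply: SP; apply: sBS => N LN Nf; rewrite BU; split=> //; apply: fU.
  have [f Mf fF] := open_spec_basic (closed_openC cF) (BFc M LMM BM).
  apply: Mf; apply: SP; apply: sBcS => N LN Nf; rewrite BF => -[_].
  exact: fF.
(* A prime of the locus avoiding [f * g] would lie both in [B] and in its complement. *)
have [n Ifg] : exists n, idem_ideal L ((f * g) ^+ n.+1).
  apply: contrapT => nfg; have [|P [pP IP Pfg]] := @exists_prime_avoiding A _ (f * g) idI.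
    by move=> n Ifg; apply: nfg; exists n; rewrite exprS; case: idI => _ _; apply.
  have [[_ _ PZ] _ _] := pP.
  have LP : idem_locus L (Spec pP) by [].
  apply: (gB (Spec pP) LP) => /= [Pg|]; first by apply: Pfg; apply: PZ.
  by apply: (fB _ LP) => /= Pf; apply: Pfg; rewrite mulrC; apply: PZ.
have [c fc] := comax_expr n.+1 fg1.
have [d gd] := comax_expr n.+1 (etrans (addrC _ _) fc).
set u := (f * c) ^+ n.+1 in gd; set v := g ^+ n.+1 * d in gd.
have [e ee [Le [r uvE]]] : idem_ideal L (u * v).
  have [_ _ IM] := idI; have -> : u * v = (c ^+ n.+1 * d) * (f * g) ^+ n.+1.
    by rewrite /u /v !exprMn; ring.
  exact: IM.
(* The defect of idempotency of [u] is [u * (1 - u) = u * v = e * r]; the factor [1 - e] kills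
   it. *)
pose h := (1 - e) * u.
have uE : u = 1 - v by rewrite -gd; ring.
have hh : h * h = h.
  transitivity ((1 - 2 * e + e * e) * u * (1 - v)); first by rewrite -uE /h; ring.
  transitivity ((1 - 2 * e + e * e) * u - (1 - 2 * e + e * e) * (u * v)); first by ring.
  rewrite ee uvE /h; transitivity ((1 - e) * u - (e - e * e) * r); first by ring.
  by rewrite ee; ring.
have [_ ID IM] := idI.
have Ie x : idem_ideal L (e * x) by exists e => //; split=> //; exists x.
have idem_in k : k * k = k -> (L : set A) k -> idem_ideal L k.
  by move=> kk Lk; exists k => //; split=> //; exists 1; rewrite mulr1.
have notboth M x y : idem_locus L M -> x + y = 1 -> idem_ideal L x -> ~ (M : set A) y.
  move=> LMM xy /LMM Mx My; have [[_ MD _] M1 _] := spec_prime M.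
  by apply: M1; rewrite -xy; apply: MD.
(* If [h] is in [L], then [u] vanishes on the locus, so [g] is not in [M0], against [M0] being in
   [B]. Otherwise [v] vanishes there, so no point of the locus contains [f] and all of them are in
   [B]. *)
have [Lh|Lh] := pselect ((L : set A) h).
  have Iu : idem_ideal L u.
    have -> : u = h + e * u by rewrite /h; ring.
    exact: ID (idem_in _ hh Lh) (Ie u).
  exfalso; have LM0 : idem_locus L M0 by move: BM0; rewrite BU => -[].
  apply: (gB M0 LM0 _ BM0) => Mg; apply: (notboth _ _ v LM0 _ Iu); first by rewrite uE; ring.
  have [[_ _ MZ] _ _] := spec_prime M0.
  have -> : v = g ^+ n * d * g by rewrite /v exprS; ring.
  exact: MZ.
have Iv : idem_ideal L v.
  have -> : v = (1 - h) + e * (v - 1) by rewrite /h uE; ring.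
  apply: (ID _ _ _ (Ie _)); apply: idem_in.
    exact: idemN hh.
  exact: prime_ideal_idemN (spec_prime L) hh Lh.
apply/seteqP; split=> [M|M LMM]; first by rewrite BU => -[].
apply: fB => // Mf; apply: (notboth _ _ u LMM _ Iv); first by rewrite uE; ring.
have [[_ _ MZ] _ _] := spec_prime M.
have -> : u = f ^+ n * c ^+ n.+1 * f by rewrite /u exprMn exprS; ring.
exact: MZ.
Qed.

(** The image of the locus in [pSpec A] is connected, hence a single class. *)
Lemma pspec_relP L M : totally_disconnected [set: pSpec A] ->
  idem_locus L M -> clos_refl_sym_trans (spec A) (@spec_incl A) L M.
Proof.
move=> td LMM; pose p : spec A -> pSpec A := \pi_(pSpec A)%qT.
have cp : connected (p @` idem_locus L).
  apply: connected_continuous_connected; first exact: idem_locus_connected.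
  exact/continuous_subspaceT/pi_continuous.
have LL : idem_locus L L by exact: idem_ideal_sub.
have : connected_component [set: pSpec A] (p L) (p M).
  by exists (p @` idem_locus L); [split=> //; exists L | exists M].
by rewrite (td (p L) I) => /esym/eqmodP/asboolP.
Qed.
End Spectrum.

(** * Bezout and Hermite rings *)

Section Bezout.
Variable A : comNzRingType.
Implicit Types (P : set A) (L M N : spec A) (a b d : A).

(** Induction on the number of generators reduces to two. *)
Lemma bezout_ringP : bezout_ring A <->
  forall a b, exists d a' b' u v, [/\ a = d * a', b = d * b' & d = u * a + v * b].
Proof.
split=> [bA a b|bA].
  pose g (i : 'I_2) := if i == 0 then a else b.
  have [d gd] := bA 2 g.
  have sum2 (c : 'I_2 -> A) : \sum_(i < 2) c i * g i = c 0 * a + c 1 * b.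
    by rewrite big_ord_recr big_ord1 /=; congr (c _ * _ + c _ * _); apply: val_inj.
  have div x y : exists r, x * a + y * b = d * r.
    have : fg_ideal g (x * a + y * b).
      by exists (fun i => if i == 0 then x else y); rewrite sum2.
    by rewrite gd => -[r ->]; exists r; rewrite mulrC.
  have [a' a'E] := div 1 0; have [b' b'E] := div 0 1.
  have : fg_ideal g d by rewrite gd; exists 1; rewrite mul1r.
  case=> c; rewrite sum2 => dE.
  by exists d, a', b', (c 0), (c 1); split; rewrite -?a'E -?b'E //; ring.
elim=> [|m IHm] g.
  exists 0; apply/seteqP; split=> x /= [c ->].
    by rewrite big_ord0; exists 0; rewrite mulr0.
  by exists (fun=> 0); rewrite big_ord0 mulr0.
have [e geE] := IHm (fun i => g (lift ord0 i)).
have [d [a' [b' [u [v [aE bE dE]]]]]] := bA (g ord0) e.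
have : fg_ideal (fun i => g (lift ord0 i)) e by rewrite geE; exists 1; rewrite mul1r.
case=> c ce; exists d; apply/seteqP; split=> x /= [k ->].
  rewrite big_ord_recl; have : fg_ideal (fun i => g (lift ord0 i))
     (\sum_(i < m) k (lift ord0 i) * g (lift ord0 i)) by exists (fun i => k (lift ord0 i)).
  rewrite geE => -[r ->]; exists (k ord0 * a' + r * b').
  by rewrite aE bE; ring.
exists (fun i => if unlift ord0 i is Some j then k * v * c j else k * u).
rewrite big_ord_recl unlift_none [in LHS]dE [in LHS]ce mulrDr !mulrA; congr (_ + _).
by rewrite mulr_sumr; apply: eq_bigr => i _; rewrite liftK; ring.
Qed.

Lemma hermite_ringP : hermite_ring A <->
  forall a b, exists d a' b' u v, [/\ a = d * a', b = d * b' & u * a' + v * b' = 1].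
Proof.
split=> hA a b.
  have [d [a' [b' [aE bE uv]]]] := hA a b.
  have : [set: A] 1 by []. 
  by rewrite -uv => -[u [v uvE]]; exists d, a', b', u, v.
have [d [a' [b' [u [v [aE bE uv]]]]]] := hA a b.
exists d, a', b'; split=> //; apply/seteqP; split=> // x _.
by exists (x * u), (x * v); rewrite -[LHS]mulr1 -uv; ring.
Qed.

Lemma hermite_bezout : hermite_ring A -> bezout_ring A.
Proof.
move=> /hermite_ringP hA; apply/bezout_ringP => a b.
have [d [a' [b' [u [v [-> -> uv]]]]]] := hA a b.
by exists d, a', b', u, v; split=> //; rewrite -[LHS]mulr1 -uv; ring.
Qed.

(** This says that [A_P] is a chain ring, with denominators cleared. A cofactor outside [P] serves
    as [s]; if both are in [P], then [1 - (u * a' + v * b')] is outside [P] and kills [d]. *)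
Lemma bezout_local_chain P a b : bezout_ring A -> prime_ideal P ->
  exists s r, ~ P s /\ (s * a = b * r \/ s * b = a * r).
Proof.
move=> /bezout_ringP bA pP; have [[_ PD PZ] P1 PM] := pP.
have [d [a' [b' [u [v [aE bE dE]]]]]] := bA a b.
have [Pa'|Pa'] := pselect (P a'); last first.
  by exists a', b'; split=> //; right; rewrite aE bE; ring.
have [Pb'|Pb'] := pselect (P b'); last first.
  by exists b', a'; split=> //; left; rewrite aE bE; ring.
exists (1 - (u * a' + v * b')), 0; split.
  by apply: prime_ideal_onem pP _; apply: (PD); apply: PZ.
left; rewrite mulr0 aE.
transitivity ((d - (u * (d * a') + v * (d * b'))) * a'); first by ring.
by rewrite -aE -bE -dE subrr mul0r.
Qed.

(* The primes below a given prime form a chain, so "having a common lower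
   bound" is transitive. *)
Lemma pspec_common_prime L M : bezout_ring A ->
  clos_refl_sym_trans (spec A) (@spec_incl A) L M ->
  exists N, spec_incl N L /\ spec_incl N M.
Proof.
move=> bA; elim=> {L M} [L M LM|L|L M _ [N []]|L M K _ [N [NL NM]] _ [N' [NM' NK]]].
- by exists L; split.
- by exists L; split.
- by exists N; split.
suff [NN'|NN'] : spec_incl N N' \/ spec_incl N' N.
- by exists N; split=> // x /NN' /NK.
- by exists N'; split=> // x /NN' /NL.
apply: contrapT => /not_orP [/existsNP [a /not_implyP [Na Na']] /existsNP [b /not_implyP [Nb' Nb]]].
have [s [r [Ms]]] := bezout_local_chain a b bA (spec_prime M).
have [[_ _ NZ] _ NP] := spec_prime N; have [[_ _ NZ'] _ NP'] := spec_prime N'.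
case=> E.
  have /NP' [/NM'|] // : (N' : set A) (s * a) by rewrite E mulrC; apply: NZ'.
have /NP [/NM|] // : (N : set A) (s * b) by rewrite E mulrC; apply: NZ.
Qed.

Definition idempotents_split_zero_products : Prop :=
  forall a b, a * b = 0 -> exists e n,
    [/\ e * e = e, e * a ^+ n = 0 & (1 - e) * b ^+ n = 0].

(* Otherwise some prime [L] contains every idempotent [e] such that [e a] or
   [e b] is nilpotent. All primes with the same idempotents as [L] are related
   to [L], so [a] and [b] cannot both be non-nilpotent modulo [idem_ideal L]: a
   common lower prime would miss both, yet contain [a b]. *)
Lemma bezout_idempotents_split : bezout_ring A ->
  totally_disconnected [set: pSpec A] -> idempotents_split_zero_products.
Proof.
move=> bA td a b ab0.
pose K x := [set e : A | e * e = e /\ exists n, e * x ^+ n = 0].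
have KM x e f : K x e -> f * f = f -> K x (e * f).
  move=> [ee [n en]] ff; split; first by rewrite mulrACA ee ff.
  by exists n; rewrite mulrAC en mul0r.
have KU x e f : K x e -> K x f -> K x (e + f - e * f).
  move=> [ee [n en]] [ff [m fm]]; split; first exact: idemU ee ff.
  exists (n + m); rewrite exprD.
  transitivity ((e * x ^+ n) * x ^+ m + (f * x ^+ m) * x ^+ n * (1 - e)); first by ring.
  by rewrite en fm !mul0r addr0.
pose J := [set x | exists e f, [/\ K a e, K b f & (1 - e) * (1 - f) * x = 0]].
have idJ : is_ideal J.
  have K0 x : K x 0 by split; [rewrite mulr0 | exists 0; rewrite mul0r].
  split=> [|x y [e [f [Ke Kf efx]]] [e' [f' [Ke' Kf' efy]]]|r x [e [f [Ke Kf efx]]]].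
  - by exists 0, 0; rewrite mulr0; split.
  - exists (e + e' - e * e'), (f + f' - f * f'); split; [exact: KU | exact: KU |].
    transitivity ((1 - e') * (1 - f') * ((1 - e) * (1 - f) * x) +
      (1 - e) * (1 - f) * ((1 - e') * (1 - f') * y)); first by ring.
    by rewrite efx efy !mulr0 addr0.
  - by exists e, f; split=> //; rewrite mulrCA efx mulr0.
have [[e [f [[ee [n en]] [ff [m fm]] ef1]]]|J1] := pselect (J 1).
  exists e, (n + m); split=> //; first by rewrite exprD mulrA en mul0r.
  have -> : 1 - e = (1 - e) * f + (1 - e) * (1 - f) * 1 by ring.
  rewrite ef1 addr0 exprD.
  by transitivity ((1 - e) * b ^+ n * (f * b ^+ m)); [ring | rewrite fm mulr0].
have [P [mP JP]] := exists_maximal idJ J1.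
pose L := Spec (maximal_ideal_prime mP); have idI := idem_ideal_is_ideal L.
(* If [x ^+ n = e * r] with [e] an idempotent of [L], then [1 - e] kills [x ^+ n], so it lies in
   [K x] and hence in [L] along with [e]. *)
have inK x : (K x `<=` P) -> forall n, ~ idem_ideal L (x ^+ n).
  move=> KP n [e ee [Pe [r xE]]].
  apply: (prime_ideal_onem (spec_prime L) Pe); apply: KP; split; first exact: idemN ee.
  exists n; rewrite xE; transitivity ((e - e * e) * r); first by ring.
  by rewrite ee subrr mul0r.
have K0 x : K x 0 by split; [rewrite mulr0 | exists 0; rewrite mul0r].
have [|Pa [pPa IPa Paa]] := exists_prime_avoiding idI (inK a _).
  move=> e Ke; apply: JP; exists e, 0; split=> //; case: Ke => ee _.
  by transitivity (e - e * e); [ring | rewrite ee subrr].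
have [|Pb [pPb IPb Pbb]] := exists_prime_avoiding idI (inK b _).
  move=> e Ke; apply: JP; exists 0, e; split=> //; case: Ke => ee _.
  by transitivity (e - e * e); [ring | rewrite ee subrr].
have LPa := pspec_relP (M := Spec pPa) td IPa.
have LPb := pspec_relP (M := Spec pPb) td IPb.
have [N [NPa NPb]] := pspec_common_prime bA (rst_trans _ _ _ _ _ (rst_sym _ _ _ _ LPa) LPb).
have [[N0 _ _] _ NM] := spec_prime N.
have /NM [/NPa|/NPb] // : (N : set A) (a * b) by rewrite ab0.
Qed.

(* Given a unimodular [(a', b', z)] with [d z = 0], the pair
   [(a' + s z, b' + t z)] is still a pair of cofactors for [d]. Let [g] generate
   [(a', b')], say [a' = g x], [b' = g y], [g = p a' + q b']. Where [p x + q y]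
   is a unit, [(s, t) = (-q, p)] makes it unimodular; where [g] is nilpotent,
   [z] is a unit and [(s, t) = (1, 0)] does. The idempotent glues both choices. *)
Lemma bezout_split_hermite :
  bezout_ring A -> idempotents_split_zero_products -> hermite_ring A.
Proof.
move=> /bezout_ringP bA split0; apply/hermite_ringP => a b.
have [d [a' [b' [u [v [aE bE dE]]]]]] := bA a b.
have [g [x [y [p [q [a'E b'E gE]]]]]] := bA a' b'.
set z := 1 - (u * a' + v * b'); set w := 1 - (p * x + q * y).
have dz : d * z = 0.
  transitivity (d - (u * (d * a') + v * (d * b'))); first by rewrite /z; ring.
  by rewrite -aE -bE -dE subrr.
have gw : g * w = 0.
  transitivity (g - (p * (g * x) + q * (g * y))); first by rewrite /w; ring.
  by rewrite -a'E -b'E -gE subrr.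
have [e [n [ee eg ew]]] := split0 _ _ gw.
pose s := e - (1 - e) * q; pose t := (1 - e) * p.
pose J := [set r | exists k l, r = k * (a' + s * z) + l * (b' + t * z)].
suff [k [l kl]] : J 1.
  exists d, (a' + s * z), (b' + t * z), k, l; split=> //.
    by rewrite mulrDr mulrCA dz mulr0 addr0.
  by rewrite mulrDr mulrCA dz mulr0 addr0.
have idJ : is_ideal J := ideal_linear_comb _ _.
apply: contrapT => /(exists_maximal idJ) [P [/maximal_ideal_prime pP JP]].
have [[P0 PD PZ] P1 PM] := pP.
have PZr c r : P c -> P (c * r) by rewrite mulrC; apply: PZ.
have PB c r : P c -> P r -> P (c - r) by case: pP => idP _ _; exact: is_idealB.
have Ps : P (a' + s * z) by apply: JP; exists 1, 0; ring.
have Pt : P (b' + t * z) by apply: JP; exists 0, 1; ring.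
have Pz_absurd : P a' -> P b' -> P z -> False.
  move=> Pa' Pb' Pz; apply: P1; have -> : 1 = z + (u * a' + v * b') by rewrite /z; ring.
  by apply: (PD _ _ Pz); apply: (PD); apply: PZ.
have [Pe|Pe] := pselect (P e).
  have Pw : P w.
    apply: (prime_ideal_expr (n := n)) => //.
    have : P ((1 - e) * w ^+ n) by rewrite ew.
    by move=> /PM [/(prime_ideal_onem pP Pe)|].
  have Pz : P z.
    (* As [x * b' = y * a'], the middle bracket is [z * (p * x + q * y)] modulo [e], and [w] is the
       complement of [p * x + q * y]. *)
    have -> : z = z * w + (x * (b' + t * z) - y * (a' + s * z)) + e * (z * (p * x + q * y + y)).
      rewrite {1}a'E {1}b'E /s /t /w; ring.
    apply: (PD); last exact: PZr.
    by apply: (PD); [exact: PZ | by apply: PB; exact: PZ].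
  apply: Pz_absurd => //.
    by have -> : a' = (a' + s * z) - s * z; [ring | apply: PB => //; exact: PZ].
  by have -> : b' = (b' + t * z) - t * z; [ring | apply: PB => //; exact: PZ].
have P1e := prime_ideal_idemN pP ee Pe.
have Pg : P g.
  apply: (prime_ideal_expr (n := n)) => //.
  by have : P (e * g ^+ n) by [rewrite eg]; move=> /PM [].
have Pa' : P a' by rewrite a'E; exact: PZr.
have Pb' : P b' by rewrite b'E; exact: PZr.
apply: Pz_absurd => //.
have -> : z = (a' + s * z) - a' + (1 - e) * (z + q * z) by rewrite /s; ring.
by apply: (PD); [exact: PB | exact: PZr].
Qed.

End Bezout.

(** * Localization at a prime *)

Section LocalizedModule.
Variables (A : comNzRingType) (P : set A) (pP : prime_ideal P) (E : lmodType A).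
Implicit Types (s t a : A) (e : E).

Lemma prime_compl1 : ~ P 1. Proof. by case: pP. Qed.

Lemma prime_complM s t : ~ P s -> ~ P t -> ~ P (s * t).
Proof. by move=> Ps Pt; case: pP => _ _ PM /PM []. Qed.

(* Denominators lying in [P] are replaced by [1], so that the fractions can be
   represented by arbitrary pairs. *)
Definition denom s := if `[< P s >] then 1 else s.

Lemma denomN s : ~ P (denom s).
Proof. by rewrite /denom; case: asboolP => // _; exact: prime_compl1. Qed.

Lemma denom_id s : ~ P s -> denom s = s.
Proof. by rewrite /denom; case: asboolP. Qed.

Definition frac_rel (x y : E * A) : bool :=
  `[< exists2 t, ~ P t & t *: (denom y.2 *: x.1) = t *: (denom x.2 *: y.1) >].

Lemma frac_rel_refl : reflexive frac_rel.
Proof. by move=> x; apply/asboolP; exists 1 => //; exact: prime_compl1. Qed.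

Lemma frac_rel_sym : symmetric frac_rel.
Proof. by move=> x y; apply/asboolP/asboolP => -[t Pt ts]; exists t. Qed.

Lemma frac_rel_trans : transitive frac_rel.
Proof.
move=> y x z /asboolP [t Pt txy] /asboolP [u Pu uyz]; apply/asboolP.
exists (u * t * denom y.2).
  by apply: prime_complM; [exact: prime_complM | exact: denomN].
have -> : (u * t * denom y.2) *: (denom z.2 *: x.1) = (u * denom z.2) *: (t *: (denom y.2 *: x.1)).
  by rewrite !scalerA; congr (_ *: _); ring.
have -> : (u * t * denom y.2) *: (denom x.2 *: z.1) = (t * denom x.2) *: (u *: (denom y.2 *: z.1)).
  by rewrite !scalerA; congr (_ *: _); ring.
by rewrite txy -uyz !scalerA; congr (_ *: _); ring.
Qed.

Canonical frac_equiv := EquivRel frac_rel frac_rel_refl frac_rel_sym frac_rel_trans.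

(** The conditions on [E] quantify over all localizations, so applying them requires a concrete
    model. *)
Definition loc_module : Type := {eq_quot frac_rel}%qT.
HB.instance Definition _ := Choice.on loc_module.

Definition frac e s : loc_module := (\pi_({eq_quot frac_rel}) (e, s))%qT.

Lemma fracP (x : loc_module) : exists e s, ~ P s /\ x = frac e s.
Proof.
elim/quotW: x => -[e s]; exists e, (denom s); split; first exact: denomN.
apply/eqmodP/asboolP; exists 1; first exact: prime_compl1.
by rewrite /= (denom_id (@denomN s)).
Qed.

Lemma eq_frac e s e' s' : ~ P s -> ~ P s' ->
  frac e s = frac e' s' <-> exists2 t, ~ P t & t *: (s' *: e) = t *: (s *: e').
Proof.
move=> Ps Ps'; split=> [/eqmodP/asboolP|] /=; first by rewrite !denom_id.
by move=> ts; apply/eqmodP/asboolP; rewrite /= !denom_id.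
Qed.

Lemma eq_frac1 e s e' s' : ~ P s -> ~ P s' -> s' *: e = s *: e' -> frac e s = frac e' s'.
Proof. by move=> Ps Ps' ee; apply/eq_frac => //; exists 1; [exact: prime_compl1 | rewrite ee]. Qed.

Definition num (x : loc_module) : E := (repr (x : {eq_quot frac_rel}%qT)).1.
Definition den (x : loc_module) : A := denom (repr (x : {eq_quot frac_rel}%qT)).2.

Lemma denN x : ~ P (den x). Proof. exact: denomN. Qed.

(** Operations are defined on chosen representatives; this relation makes them computable on
    arbitrary fractions. *)
Lemma num_den_frac e s : ~ P s ->
  exists2 t, ~ P t & t *: (s *: num (frac e s)) = t *: (den (frac e s) *: e).
Proof.
move=> Ps; have : frac_rel (repr (frac e s : {eq_quot frac_rel}%qT)) (e, s).
  by apply/eqmodP; rewrite reprK.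
by move=> /asboolP /=; rewrite (denom_id Ps).
Qed.

Definition loc_add x y := frac (den y *: num x + den x *: num y) (den x * den y).
Definition loc_opp x := frac (- num x) (den x).

Lemma add_frac e s e' s' : ~ P s -> ~ P s' ->
  loc_add (frac e s) (frac e' s') = frac (s' *: e + s *: e') (s * s').
Proof.
move=> Ps Ps'; have [t Pt te] := num_den_frac e Ps; have [t' Pt' te'] := num_den_frac e' Ps'.
apply/eq_frac; [by apply: prime_complM; exact: denN | exact: prime_complM |].
exists (t * t'); first exact: prime_complM.
set x := frac e s in te *; set y := frac e' s' in te' *.
transitivity ((t' * s' * den y) *: (t *: (s *: num x)) + (t * s * den x) *: (t' *: (s' *: num y))).
  by rewrite !scalerDr !scalerA; congr (_ *: _ + _ *: _); ring.
by rewrite te te' !scalerDr !scalerA; congr (_ *: _ + _ *: _); ring.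
Qed.

Lemma opp_frac e s : ~ P s -> loc_opp (frac e s) = frac (- e) s.
Proof.
move=> Ps; have [t Pt te] := num_den_frac e Ps.
by apply/eq_frac => //; [exact: denN | exists t => //; rewrite !scalerN te].
Qed.

Lemma loc_addA : associative loc_add.
Proof.
move=> x y z; have [e [s [Ps ->]]] := fracP x; have [f [t [Pt ->]]] := fracP y.
have [g [u [Pu ->]]] := fracP z; rewrite !add_frac //; try exact: prime_complM.
congr frac; last by ring.
by rewrite !scalerDr !scalerA addrA; congr (_ *: _ + _ *: _ + _ *: _); ring.
Qed.

Lemma loc_addC : commutative loc_add.
Proof.
move=> x y; have [e [s [Ps ->]]] := fracP x; have [f [t [Pt ->]]] := fracP y.
by rewrite !add_frac // addrC mulrC.
Qed.

Lemma loc_add0 : left_id (frac 0 1) loc_add.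
Proof.
move=> x; have [e [s [Ps ->]]] := fracP x; rewrite add_frac //; last exact: prime_compl1.
by rewrite scaler0 add0r scale1r mul1r.
Qed.

Lemma loc_addN : left_inverse (frac 0 1) loc_opp loc_add.
Proof.
move=> x; have [e [s [Ps ->]]] := fracP x; rewrite opp_frac // add_frac //.
apply: eq_frac1; [exact: prime_complM | exact: prime_compl1 |].
by rewrite scalerN addNr !scaler0.
Qed.

HB.instance Definition _ :=
  GRing.isZmodule.Build loc_module loc_addA loc_addC loc_add0 loc_addN.

Lemma fracD e s e' s' : ~ P s -> ~ P s' ->
  frac e s + frac e' s' = frac (s' *: e + s *: e') (s * s').
Proof. exact: add_frac. Qed.

End LocalizedModule.

(** * The ring [A_P] and its action on [E_P] *)

Section LocalizedScale.
Variables (A : comNzRingType) (P : set A) (pP : prime_ideal P).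
Local Notation locA := (loc_module pP A^o).

(** Taking [E] to be [A^o] gives the multiplication of [A_P], so the ring and module laws share
    their proofs. *)
Definition loc_scale (E : lmodType A) (b : locA) (x : loc_module pP E) : loc_module pP E :=
  frac pP ((num b : A) *: num x) (den b * den x).

Lemma scale_frac (E : lmodType A) (a s t : A) (e : E) : ~ P s -> ~ P t ->
  loc_scale (frac pP (a : A^o) s) (frac pP e t) = frac pP (a *: e) (s * t).
Proof.
move=> Ps Pt; have [u Pu ua] := num_den_frac pP (a : A^o) Ps.
have [v Pv ve] := num_den_frac pP e Pt.
apply/eq_frac; [by apply: prime_complM => //; exact: denN | exact: prime_complM |].
exists (u * v); first exact: prime_complM.
set b := frac pP (a : A^o) s in ua *; set x := frac pP e t in ve *.
transitivity ((u * (s * (num b : A))) *: (v *: (t *: num x))).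
  by rewrite !scalerA; congr (_ *: _); ring.
have -> : u * (s * (num b : A)) = u * (den b * a) by exact: ua.
by rewrite ve !scalerA; congr (_ *: _); ring.
Qed.

Lemma loc_scaleA (E : lmodType A) (b c : locA) (x : loc_module pP E) :
  loc_scale b (loc_scale c x) = loc_scale (loc_scale b c) x.
Proof.
have [a [s [Ps ->]]] := fracP b; have [a' [s' [Ps' ->]]] := fracP c.
have [e [t [Pt ->]]] := fracP x.
rewrite (scale_frac a' e Ps' Pt) (scale_frac a (a' : A^o) Ps Ps').
rewrite (scale_frac a _ Ps (prime_complM pP Ps' Pt)).
rewrite (scale_frac _ e (prime_complM pP Ps Ps') Pt).
by congr frac; [exact: scalerA | exact: mulrA].
Qed.

Lemma loc_scale1 (E : lmodType A) : left_id (frac pP (1 : A^o) 1) (@loc_scale E).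
Proof.
move=> x; have [e [t [Pt ->]]] := fracP x; rewrite scale_frac //; last exact: prime_compl1 pP.
by rewrite scale1r mul1r.
Qed.

Lemma loc_scaleDr (E : lmodType A) : right_distributive (@loc_scale E) +%R.
Proof.
move=> b x y; have [a [s [Ps ->]]] := fracP b.
have [e [t [Pt ->]]] := fracP x; have [f [u [Pu ->]]] := fracP y.
have [Pst Psu] := (prime_complM pP Ps Pt, prime_complM pP Ps Pu).
rewrite (scale_frac a e Ps Pt) (scale_frac a f Ps Pu) (fracD pP _ _ Pst Psu).
rewrite (fracD pP e f Pt Pu) (scale_frac a _ Ps (prime_complM pP Pt Pu)).
apply: eq_frac1; try by repeat apply: prime_complM.
by rewrite !scalerDr !scalerA; congr (_ *: _ + _ *: _); ring.
Qed.

Lemma loc_scaleDl (E : lmodType A) (x : loc_module pP E) :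
  {morph (@loc_scale E)^~ x : b c / b + c}.
Proof.
move=> b c; have [a [s [Ps ->]]] := fracP b; have [a' [s' [Ps' ->]]] := fracP c.
have [e [t [Pt ->]]] := fracP x.
have [Pst Pst'] := (prime_complM pP Ps Pt, prime_complM pP Ps' Pt).
rewrite (scale_frac a e Ps Pt) (scale_frac a' e Ps' Pt) (fracD pP _ _ Pst Pst').
rewrite (fracD pP a a' Ps Ps') (scale_frac _ e (prime_complM pP Ps Ps') Pt).
apply: eq_frac1; try by repeat apply: prime_complM.
have -> : (s' *: (a : A^o) + s *: (a' : A^o) : A^o) = s' * (a : A) + s * (a' : A) by [].
by rewrite scalerDr !scalerA -scalerDl; congr (_ *: _); ring.
Qed.

Lemma loc_mulC : commutative (@loc_scale A^o).
Proof.
move=> b c; have [a [s [Ps ->]]] := fracP b; have [a' [s' [Ps' ->]]] := fracP c.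
rewrite (scale_frac a (a' : A^o) Ps Ps') (scale_frac a' (a : A^o) Ps' Ps).
by rewrite mulrC; congr frac; exact: mulrC.
Qed.

Lemma loc_mulDl : left_distributive (@loc_scale A^o) +%R.
Proof. by move=> b c x; exact: loc_scaleDl. Qed.

Lemma loc_one_neq0 : frac pP (1 : A^o) 1 != 0.
Proof.
apply/eqP => /eq_frac; case; try exact: prime_compl1 pP.
move=> t Pt; rewrite scaler0 scaler0 scale1r => t0; apply: Pt.
by move: t0; rewrite [LHS]mulr1 => ->; case: pP => -[].
Qed.

Definition loc_ring : Type := locA.
HB.instance Definition _ := GRing.Zmodule.on loc_ring.
HB.instance Definition _ := GRing.Zmodule_isComNzRing.Build loc_ring
  (@loc_scaleA A^o) loc_mulC (@loc_scale1 A^o) loc_mulDl loc_one_neq0.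

HB.instance Definition _ (E : lmodType A) :=
  GRing.Zmodule_isLmodule.Build loc_ring (loc_module pP E)
    (@loc_scaleA E) (@loc_scale1 E) (@loc_scaleDr E) (@loc_scaleDl E).

Definition loc_ring_map (a : A) : loc_ring := frac pP (a : A^o) 1.
Definition loc_module_map (E : lmodType A) (e : E) : loc_module pP E := frac pP e 1.

Lemma loc_module_mapD (E : lmodType A) (e f : E) :
  loc_module_map (e + f) = loc_module_map e + loc_module_map f.
Proof. by rewrite /loc_module_map fracD ?scale1r ?mulr1 //; exact: prime_compl1 pP. Qed.

Lemma loc_ring_map_additive : zmod_morphism loc_ring_map.
Proof.
move=> a b; apply/eqP; rewrite eq_sym subr_eq; apply/eqP.
by rewrite -[RHS](@loc_module_mapD A^o) subrK.
Qed.

Lemma loc_module_mapZ (E : lmodType A) (a : A) (e : E) :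
  loc_module_map (a *: e) = loc_ring_map a *: loc_module_map e.
Proof. by rewrite [RHS]scale_frac ?mulr1 //; exact: prime_compl1 pP. Qed.

Lemma loc_ring_map_monoid : monoid_morphism loc_ring_map.
Proof. by split=> // a b; exact: (@loc_module_mapZ A^o). Qed.

HB.instance Definition _ := GRing.isZmodMorphism.Build A loc_ring loc_ring_map
  loc_ring_map_additive.
HB.instance Definition _ := GRing.isMonoidMorphism.Build A loc_ring loc_ring_map
  loc_ring_map_monoid.

Lemma loc_module_map_eq0 (E : lmodType A) (e : E) :
  loc_module_map e = 0 -> exists s : A, ~ P s /\ s *: e = 0.
Proof.
move=> /eq_frac; case; try exact: prime_compl1 pP.
by move=> t Pt; rewrite !scaler0 scale1r => te; exists t.
Qed.

Lemma loc_ring_map_denom (E : lmodType A) (x : loc_module pP E) :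
  exists (e : E) (s : A), ~ P s /\ loc_ring_map s *: x = loc_module_map e.
Proof.
have [e [s [Ps ->]]] := fracP x; exists e, s; split=> //.
rewrite [LHS]scale_frac ?mul1r //; last exact: prime_compl1 pP.
by apply: eq_frac1 => //; [exact: prime_compl1 pP | rewrite scale1r].
Qed.

Lemma loc_ring_is_localization : is_localization_at P loc_ring_map.
Proof.
split=> [s Ps|b|a]; last exact: (@loc_module_map_eq0 A^o).
  exists (frac pP (1 : A^o) s : loc_ring).
  rewrite [LHS](@scale_frac A^o) //; last exact: prime_compl1 pP.
  apply: eq_frac1; [by rewrite mul1r | exact: prime_compl1 pP |].
  by rewrite mul1r scale1r.
have [a [s [Ps sb]]] := @loc_ring_map_denom A^o b.
by exists a, s; split=> //; rewrite mulrC; exact: sb.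
Qed.

Lemma loc_module_is_localized (E : lmodType A) :
  is_localized_module_at P loc_ring_map (@loc_module_map E).
Proof.
split; [exact: loc_module_mapD | exact: loc_module_mapZ | |].
  exact: loc_ring_map_denom.
exact: loc_module_map_eq0.
Qed.

End LocalizedScale.

(** * FP-injectivity over chain rings *)

Section FgSubmod.
Variables (B : comNzRingType) (V : lmodType B) (m : nat) (g : 'I_m -> V).

Lemma fg_submod_gen i : fg_submod g (g i).
Proof.
exists (fun j => (j == i)%:R); rewrite (bigD1 i) //= eqxx scale1r big1 ?addr0 //.
by move=> j /negPf ->; rewrite scale0r.
Qed.

Lemma fg_submodD x y : fg_submod g x -> fg_submod g y -> fg_submod g (x + y).
Proof.
move=> [c ->] [d ->]; exists (fun i => c i + d i).
by rewrite -big_split; apply: eq_bigr => i _; rewrite scalerDl.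
Qed.

Lemma fg_submodZ b x : fg_submod g x -> fg_submod g (b *: x).
Proof.
move=> [c ->]; exists (fun i => b * c i).
by rewrite scaler_sumr; apply: eq_bigr => i _; rewrite scalerA.
Qed.

(** Linearity holds only on the span, so the induction carries membership of the partial sums. *)
Lemma fg_submod_linear (N : lmodType B) (f : V -> N) :
  (forall x y, fg_submod g x -> fg_submod g y -> f (x + y) = f x + f y) ->
  (forall b x, fg_submod g x -> f (b *: x) = b *: f x) ->
  forall c : 'I_m -> B, f (\sum_i c i *: g i) = \sum_i c i *: f (g i).
Proof.
move=> fD fZ c.
have g0 : fg_submod g 0 by exists (fun=> 0); rewrite big1 // => i _; rewrite scale0r.
suff [_ ->] : fg_submod g (\sum_i c i *: g i) /\
  f (\sum_i c i *: g i) = \sum_i c i *: f (g i) by [].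
apply: (big_rec2 (fun x y => fg_submod g x /\ f x = y)) => [|i y x _ [gx <-]].
  by split=> //; rewrite -[in LHS](scale0r (0 : V)) fZ // scale0r.
have gi := fg_submodZ (c i) (fg_submod_gen i).
by split; [exact: fg_submodD | rewrite fD // fZ //; exact: fg_submod_gen].
Qed.
End FgSubmod.

Section ChainRing.
Variables (B : comNzRingType) (N : lmodType B).
Hypothesis chainB : forall b c : B, exists r, b = r * c \/ c = r * b.
Hypothesis divN : forall (b : B) (x : N), b != 0 -> exists y, x = b *: y.

Lemma chain_ring_min m (d : 'I_m.+1 -> B) : exists j, forall i, exists r, d i = r * d j.
Proof.
elim: m d => [|m IHm] d; first by exists ord0 => i; exists 1; rewrite mul1r ord1.
have [j dj] := IHm (fun i => d (lift ord0 i)).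
have [r [d0|dlj]] := chainB (d ord0) (d (lift ord0 j)).
  exists (lift ord0 j) => i; case: (unliftP ord0 i) => [k ->|->]; last by exists r.
  exact: dj.
exists ord0 => i; case: (unliftP ord0 i) => [k ->|->]; last by exists 1; rewrite mul1r.
by have [t ->] := dj k; exists (t * r); rewrite dlj mulrA.
Qed.

(* Induction on the rank [n]. Subtracting multiples of a generator [g j] whose
   first coordinate divides all the others, the module splits as the span of
   [g j] plus a part with zero first coordinate; divisibility provides the
   image of the first basis vector. *)
Lemma chain_divisible_extension n m (g : 'I_m -> 'rV[B]_n) (f : 'rV[B]_n -> N) :
  (forall x y, fg_submod g x -> fg_submod g y -> f (x + y) = f x + f y) ->
  (forall (r : B) x, fg_submod g x -> f (r *: x) = r *: f x) ->
  exists y : 'I_n -> N, forall x, fg_submod g x -> \sum_j x 0 j *: y j = f x.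
Proof.
elim: n m g f => [|n IHn] [|m] g f fD fZ.
1,3: exists (fun=> 0) => x xg; move: (xg) => -[c]; rewrite big_ord0 => x0;
  rewrite big1 => [|j _]; rewrite ?scaler0 //;
  by rewrite x0 -[in RHS](scale0r (0 : 'rV_ _)) fZ ?scale0r // -x0.
  exists (fun=> 0) => x xg; rewrite big_ord0.
  by rewrite (_ : x = 0 *: x) ?fZ ?scale0r //; apply/rowP => -[].
pose tl (x : 'rV[B]_n.+1) : 'rV[B]_n := \row_j x 0 (lift ord0 j).
pose cons0 (x : 'rV[B]_n) : 'rV[B]_n.+1 := \row_j (if unlift ord0 j is Some k then x 0 k else 0).
have cons0D x y : cons0 (x + y) = cons0 x + cons0 y.
  by apply/rowP => j; rewrite !mxE; case: unlift => [k|]; rewrite ?mxE ?addr0.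
have cons0Z b x : cons0 (b *: x) = b *: cons0 x.
  by apply/rowP => j; rewrite !mxE; case: unlift => [k|]; rewrite ?mxE ?mulr0.
have cons0_tl (x : 'rV[B]_n.+1) : x 0 0 = 0 -> cons0 (tl x) = x.
  move=> x0; apply/rowP => j; rewrite !mxE; case: unliftP => [k ->|->]; first by rewrite mxE.
  by rewrite x0.
have [j0 gj0] := chain_ring_min (fun i => g i 0 0); set d := g j0 0 0 in gj0.
have [c cE] : exists c : 'I_m.+1 -> B, forall i, g i 0 0 = c i * d /\ (d = 0 -> c i = 0).
  suff /choice [c cP] : forall i, exists r, g i 0 0 = r * d /\ (d = 0 -> r = 0) by exists c.
  move=> i; have [d0|dn0] := pselect (d = 0); last by have [r] := gj0 i; exists r; split.
  by have [r ->] := gj0 i; exists 0; rewrite d0 !mulr0.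
pose g' i := tl (g i - c i *: g j0).
have g'E i : cons0 (g' i) = g i - c i *: g j0.
  by rewrite cons0_tl // !mxE; have [-> _] := cE i; rewrite subrr.
have g'_span x : fg_submod g' x -> fg_submod g (cons0 x).
  move=> [k ->].
  have -> : cons0 (\sum_i k i *: g' i) = \sum_i k i *: cons0 (g' i).
    exact: (@fg_submod_linear B _ _ g' _ cons0).
  apply: (big_ind (fg_submod g)) => [|x1 x2|i _]; [|exact: fg_submodD|].
    by rewrite -(scale0r (g j0)); apply/fg_submodZ/fg_submod_gen.
  rewrite g'E; apply: fg_submodZ; apply: fg_submodD; first exact: fg_submod_gen.
  by rewrite -scaleNr; apply/fg_submodZ/fg_submod_gen.
have [|r x xg'|y yE] := IHn _ g' (fun x => f (cons0 x)).
- by move=> x1 x2 x1g x2g; rewrite cons0D fD //; exact: g'_span.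
- by rewrite cons0Z fZ //; exact: g'_span.
pose h' (x : 'rV[B]_n) := \sum_j x 0 j *: y j.
have h'D x1 x2 : h' (x1 + x2) = h' x1 + h' x2.
  by rewrite -big_split; apply: eq_bigr => j _; rewrite mxE scalerDl.
have h'Z b x : h' (b *: x) = b *: h' x.
  by rewrite scaler_sumr; apply: eq_bigr => j _; rewrite mxE scalerA.
have [y0 y0E] : exists y0, d *: y0 + h' (tl (g j0)) = f (g j0).
  have [d0|/eqP/divN H] := pselect (d = 0).
    exists 0; rewrite scaler0 add0r.
    have c0 : c j0 = 0 by have [_] := cE j0; apply.
    have <- : g' j0 = tl (g j0) by rewrite /g' c0 scale0r subr0.
    transitivity (f (cons0 (g' j0))); first by apply: yE; exact: fg_submod_gen.
    by rewrite g'E c0 scale0r subr0.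
  by have [y0 y0E] := H (f (g j0) - h' (tl (g j0))); exists y0; rewrite -y0E subrK.
pose h (x : 'rV[B]_n.+1) := x 0 0 *: y0 + h' (tl x).
have tlD x1 x2 : tl (x1 + x2) = tl x1 + tl x2 by apply/rowP => j; rewrite !mxE.
have tlZ b x : tl (b *: x) = b *: tl x by apply/rowP => j; rewrite !mxE.
have hD x1 x2 : h (x1 + x2) = h x1 + h x2.
  by rewrite /h tlD h'D !mxE scalerDl addrACA.
have hZ b x : h (b *: x) = b *: h x.
  by rewrite /h tlZ h'Z !mxE scalerDr scalerA.
exists (fun j => if unlift ord0 j is Some k then y k else y0) => x.
have -> : \sum_j x 0 j *: (if unlift ord0 j is Some k then y k else y0) = h x.
  rewrite big_ord_recl unlift_none; congr (_ + _).
  by apply: eq_bigr => j _; rewrite liftK mxE.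
case=> k ->; rewrite (fg_submod_linear fD fZ).
rewrite (@fg_submod_linear _ _ _ g _ h) //; apply: eq_bigr => i _; congr (_ *: _).
have -> : g i = cons0 (g' i) + c i *: g j0 by rewrite g'E subrK.
have gi' : fg_submod g' (g' i) := fg_submod_gen g' i.
have gj : fg_submod g (g j0) := fg_submod_gen g j0.
rewrite hD hZ (fD _ _ (g'_span _ gi') (fg_submodZ (c i) gj)) (fZ _ _ gj).
have h_cons0 w : h (cons0 w) = h' w.
  rewrite /h !mxE unlift_none scale0r add0r; congr h'.
  by apply/rowP => j; rewrite !mxE liftK.
by rewrite h_cons0 -[f (g j0)]y0E; congr (_ + _); exact: yE.
Qed.

Lemma row_comb_linear n (y : 'I_n -> N) :
  linear (fun x : 'rV[B]_n => \sum_j x 0 j *: y j).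
Proof.
move=> b x x'; rewrite scaler_sumr -big_split; apply: eq_bigr => j _.
by rewrite !mxE scalerDl scalerA.
Qed.

Lemma chain_divisible_fp_injective : fp_injective N.
Proof.
move=> n m g f fD fZ; have [y yE] := chain_divisible_extension fD fZ.
pose hL := GRing.isLinear.Build _ _ _ _ _ (row_comb_linear y).
by exists (HB.pack_for {linear 'rV[B]_n -> N} (fun x : 'rV[B]_n => \sum_j x 0 j *: y j) hL).
Qed.
End ChainRing.

(** * Local conditions on a module *)

Section LocalConditions.
Variables (A : comNzRingType) (E : lmodType A).
Implicit Types (P : set A) (a b s d : A) (e : E).

(** For a prime [P], this means that [e] has non-zero image in [E_P]. *)
Definition supports P e := forall s, ~ P s -> s *: e != 0.

Lemma domain_on_support_local P e a b : domain_on_support E -> prime_ideal P ->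
  supports P e -> a * b = 0 -> exists2 s, ~ P s & s * a = 0 \/ s * b = 0.
Proof.
move=> domE pP suppe ab0.
have ne0 : exists n : loc_module pP E, n != 0.
  exists (loc_module_map pP e); apply/eqP => /loc_module_map_eq0 [s [Ps se]].
  by have := suppe s Ps; rewrite se eqxx.
have := domE P pP _ _ _ _ (loc_ring_is_localization pP) (loc_module_is_localized pP E) ne0.
move=> /(_ (loc_ring_map pP a) (loc_ring_map pP b)).
rewrite -rmorphM ab0 rmorph0 => /(_ erefl).
by case=> /(@loc_module_map_eq0 _ _ pP A^o) [s [Ps sE]]; exists s => //; [left|right].
Qed.

(** Each use of the local domain property either yields the annihilator or removes one factor [d];
    the induction therefore generalizes over the multiplier [s]. *)
Lemma domain_on_support_nilpotent P e d n : domain_on_support E -> prime_ideal P ->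
  supports P e -> d ^+ n = 0 -> exists2 s, ~ P s & s * d = 0.
Proof.
move=> domE pP suppe dn.
suff H s : ~ P s -> s * d ^+ n = 0 -> exists2 s, ~ P s & s * d = 0.
  by apply: (H 1); [exact: prime_compl1 pP | rewrite dn mulr0].
elim: n {dn} s => [|n IHn] s Ps.
  by rewrite expr0 mulr1 => s0; exfalso; apply: Ps; rewrite s0; case: pP => -[].
rewrite exprS mulrA => /(domain_on_support_local domE pP suppe) [t Pt [tsd|tdn]].
  by exists (t * s); [exact: prime_complM | rewrite -mulrA].
exact: IHn tdn.
Qed.

(* Multiplication by [a] is injective on the local domain, so [a r |-> r e] is a
   well-defined map on a principal ideal; FP-injectivity extends it, which
   divides [e] by [a]. *)
Lemma locally_fp_injective_divides P a e : domain_on_support E ->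
  locally_fp_injective E -> maximal_ideal P ->
  (exists2 s, ~ P s & s * a = 0) \/ exists s e', ~ P s /\ s *: e = a *: e'.
Proof.
move=> domE fpE mP; have pP := maximal_ideal_prime mP.
have [[s Ps sa]|sa] := pselect (exists2 s, ~ P s & s * a = 0); first by left; exists s.
right; have [[s Ps se]|se] := pselect (exists2 s, ~ P s & s *: e = 0).
  by exists s, 0; rewrite se scaler0.
have locA := loc_ring_is_localization pP; have locE := loc_module_is_localized pP E.
have domP : is_domain (loc_ring pP).
  apply: (domE P pP _ _ _ _ locA locE); exists (loc_module_map pP e).
  by apply/eqP => /loc_module_map_eq0 [s [Ps se0]]; apply: se; exists s.
have fpP := fpE P mP _ _ _ _ locA locE.
pose alpha := loc_ring_map pP a; pose x := loc_module_map pP e.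
have alpha0 : alpha <> 0.
  by move=> /(@loc_module_map_eq0 _ _ pP A^o) [s [Ps s0]]; apply: sa; exists s.
pose g (i : 'I_1) : 'rV[loc_ring pP]_1 := \row_j alpha.
have gE y : fg_submod g y -> exists r, y 0 0 = r * alpha.
  by move=> [c ->]; exists (c 0); rewrite big_ord1 !mxE.
(* [f0] is division by [alpha], with the junk value [0] on non-multiples; it is well determined on
   multiples because [A_P] is a domain. *)
have /choice [f0 f0E] (b : loc_ring pP) : exists r, (exists r, b = r * alpha) -> b = r * alpha.
  by have [[r]|nr] := pselect (exists r, b = r * alpha); [exists r | exists 0].
have f0_uniq r (b : loc_ring pP) : b = r * alpha -> f0 b = r.
  move=> bE; have bE' := f0E b (ex_intro _ r bE).
  suff /domP [/eqP|//] : (f0 b - r) * alpha = 0 by rewrite subr_eq0 => /eqP.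
  by rewrite mulrBl -bE' -bE subrr.
have [y z yg zg|r y yg|h hE] := fpP _ _ g (fun y => f0 (y 0 0) *: x).
- have [r yr] := gE _ yg; have [t zt] := gE _ zg.
  rewrite (f0_uniq (r + t)); last by rewrite mxE yr zt mulrDl.
  by rewrite (f0_uniq _ _ yr) (f0_uniq _ _ zt) scalerDl.
- have [t yt] := gE _ yg.
  rewrite (f0_uniq (r * t)); last by rewrite mxE yt mulrA.
  by rewrite (f0_uniq _ _ yt) scalerA.
have := hE _ (fg_submod_gen g 0).
rewrite (f0_uniq 1); last by rewrite mxE mul1r.
have -> : g 0 = alpha *: (const_mx 1) by apply/rowP => j; rewrite !mxE mulr1.
rewrite linearZ scale1r; move: (h _) => n nE.
have [e' [s [Ps sn]]] := loc_ring_map_denom n.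
have : loc_module_map pP (s *: e - a *: e') = 0.
  rewrite loc_module_mapD -scaleNr !loc_module_mapZ -sn.
  have -> : loc_ring_map pP (- a) = - alpha by rewrite -rmorphN.
  by rewrite -/x -nE !scalerA -scalerDl mulrC mulNr subrr scale0r.
move=> /loc_module_map_eq0 [t [Pt]]; rewrite scalerBr => /eqP; rewrite subr_eq0 => /eqP tE.
exists (t * s), (t *: e'); split; first exact: prime_complM.
by rewrite -scalerA tE !scalerA mulrC.
Qed.

End LocalConditions.

(** * The trivial extension *)

Section TrivialExtension.
Variables (A : comNzRingType) (E : lmodType A).
Local Notation R := (triv_ext E).
Implicit Types (P : set A) (a b d : A) (e f : E) (x y : R).

Lemma te_mulE x y : x * y = (x.1 * y.1, x.1 *: y.2 + y.1 *: x.2).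
Proof. by []. Qed.

Lemma te_addE x y : x + y = (x.1 + y.1, x.2 + y.2).
Proof. by []. Qed.

Lemma te_expr1 x n : (x ^+ n).1 = x.1 ^+ n.
Proof. by elim: n => [|n IHn]; rewrite ?expr0 // !exprS te_mulE /= IHn. Qed.

Lemma te_sqr0 x : x.1 = 0 -> x * x = 0.
Proof. by move=> x0; rewrite te_mulE x0 mul0r scale0r addr0. Qed.

(** Elements with zero first coordinate square to zero, so an idempotent of [A] still works in [R]
    once the exponent is doubled. *)
Lemma te_idempotents_split :
  idempotents_split_zero_products A -> idempotents_split_zero_products R.
Proof.
move=> splitA x y xy0; have [] := splitA x.1 y.1; first by case: xy0.
move=> e [n [ee ex ey]].
pose ie : R := (e, 0); have ie_idem : ie * ie = ie.
  by rewrite te_mulE /= ee scaler0 addr0.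
have ieN_idem : (1 - ie) * (1 - ie) = 1 - ie := idemN ie_idem.
have kill (k z : R) : k * k = k -> k.1 * z.1 ^+ n = 0 -> k * z ^+ (n + n) = 0.
  move=> kk kz; rewrite -kk exprD mulrACA; apply: te_sqr0.
  by rewrite te_mulE /= te_expr1.
by exists ie, (n + n); split=> //; apply: kill.
Qed.

Lemma bezout_te_base : bezout_ring R -> bezout_ring A.
Proof.
move=> /bezout_ringP bR; apply/bezout_ringP => a b.
have [d [a' [b' [u [v [aE bE dE]]]]]] := bR (a, 0) (b, 0).
exists d.1, a'.1, b'.1, u.1, v.1; split; [by case: aE | by case: bE |].
by rewrite [in LHS]dE.
Qed.

(** [R] acts on [0 x E] through [A], so submodules of [E] are the ideals of [R] contained in
    [0 x E]. *)
Lemma bezout_te_fg_cyclic : bezout_ring R -> fg_submodules_cyclic E.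
Proof.
move=> bR m v; pose g (i : 'I_m) : R := (0, v i).
have gsum (c : 'I_m -> R) : \sum_i c i * g i = (0, \sum_i (c i).1 *: v i) :> R.
  apply: (big_ind2 (fun (x : R) e => x = (0, e))) => // [x e y f -> ->|i _].
    by rewrite te_addE /= addr0.
  by rewrite te_mulE /= mulr0 scale0r addr0.
have [d gd] := bR m g.
have : fg_ideal g d by rewrite gd; exists 1; rewrite mul1r.
move=> [c]; rewrite gsum => dE.
exists d.2; apply/seteqP; split=> x /= [k ->].
  have : fg_ideal g (0, \sum_i k i *: v i) by exists (fun i => (k i, 0)); rewrite gsum.
  rewrite gd => -[r [_ ->]]; exists r.1.
  by rewrite dE /= scale0r addr0.
have : principal_ideal d (((k, 0) : R) * d) by exists (k, 0).
rewrite -gd => -[c']; rewrite gsum => -[_]; rewrite /= scaler0 addr0 => ->.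
by exists (fun i => (c' i).1).
Qed.

(** Compare [(a, 0)] and [(0, e)] at the prime [P x E]: the first coordinate of one relation kills
    [a], the second coordinate of the other divides [e]. *)
Lemma bezout_te_divides P a e : bezout_ring R -> prime_ideal P ->
  (exists2 s, ~ P s & s * a = 0) \/ exists s e', ~ P s /\ s *: e = a *: e'.
Proof.
move=> bR pP; have [[P0 PD PZ] P1 PM] := pP.
have pQ : prime_ideal [set x : R | P x.1].
  by split=> // [|x y]; [split=> [|x y|r x] //; [exact: PD | exact: PZ] | exact: PM].
have [s [r [Ps]]] := bezout_local_chain ((a, 0) : R) ((0, e) : R) bR pQ.
case=> -[E1 E2]; first by left; exists s.1 => //; rewrite E1 mul0r.
by right; exists s.1, r.2; split=> //; move: E2; rewrite /= scale0r scaler0 !addr0.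
Qed.

(** * Localizations of [A] and [E] when [R] is Bezout *)

Section LocalOfBezout.
Variables (P : set A) (B : comNzRingType) (phi : {rmorphism A -> B}).
Variables (N : lmodType B) (psi : E -> N).
Hypotheses (bR : bezout_ring R) (pP : prime_ideal P).
Hypotheses (locB : is_localization_at P phi) (locN : is_localized_module_at P phi psi).

(** After clearing denominators this is [bezout_te_divides], whose first alternative would make [b]
    zero. *)
Lemma localization_divisible (b : B) (n : N) : b != 0 -> exists n', n = b *: n'.
Proof.
have [unitB fracB kerB] := locB; have [psiD psiZ fracN kerN] := locN.
move=> b0; have [a [s [Ps bs]]] := fracB b; have [e [t [Pt nt]]] := fracN n.
have [s' s's] := unitB s Ps; have [t' t't] := unitB t Pt.
have [[u Pu ua]|[u [e' [Pu ue]]]] := bezout_te_divides a e bR pP; have [u' u'u] := unitB u Pu.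
  exfalso; move/eqP: b0; apply.
  transitivity (b * (phi s * s') * (phi u * u')); first by rewrite s's u'u !mulr1.
  transitivity (b * phi s * phi u * (s' * u')); first by ring.
  by rewrite bs -rmorphM mulrC [a * u]mulrC ua rmorph0 mulr0.
exists ((u' * t' * phi s) *: psi e').
transitivity ((u' * t') *: (phi a *: psi e')); last by rewrite -bs !scalerA; congr (_ *: _); ring.
rewrite -psiZ -ue psiZ -nt !scalerA.
transitivity ((phi u * u' * (phi t * t')) *: n); first by rewrite u'u t't mulr1 scale1r.
by congr (_ *: _); ring.
Qed.

Lemma localization_chain (b c : B) : exists r, b = r * c \/ c = r * b.
Proof.
have [unitB fracB kerB] := locB.
have [a [s [Ps bs]]] := fracB b; have [a' [t [Pt ct]]] := fracB c.
have [s' s's] := unitB s Ps; have [t' t't] := unitB t Pt.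
have [u [r [Pu ur]]] := bezout_local_chain a a' (bezout_te_base bR) pP.
have [u' u'u] := unitB u Pu.
have divide (x y y' : B) k l p q : x * phi k = phi p -> y * phi l = phi q ->
    phi k * y' = 1 -> u * p = q * r -> x = (phi r * phi l * u' * y') * y.
  move=> xk yl ky up.
  transitivity (x * (phi k * y') * (phi u * u')); first by rewrite ky u'u !mulr1.
  transitivity (phi u * (x * phi k) * (u' * y')); first by ring.
  rewrite xk -rmorphM up rmorphM -yl; ring.
case: ur => ur; [exists (phi r * phi t * u' * s'); left | exists (phi r * phi s * u' * t'); right].
  exact: divide bs ct s's ur.
exact: divide ct bs t't ur.
Qed.

(** Dividing [n] by [b] and then by [c] writes it as a multiple of [b * c]. *)
Lemma localization_domain (n : N) : n != 0 -> is_domain B.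
Proof.
move=> n0 b c bc0; have [b0|/eqP b0] := pselect (b = 0); first by left.
have [c0|/eqP c0] := pselect (c = 0); first by right.
have [n1 nE] := localization_divisible n b0; have [n2 n1E] := localization_divisible n1 c0.
by move: n0; rewrite nE n1E scalerA bc0 scale0r eqxx.
Qed.

Lemma localization_fp_injective : fp_injective N.
Proof.
by apply: chain_divisible_fp_injective;
  [exact: localization_chain | exact: localization_divisible].
Qed.

End LocalOfBezout.

Lemma bezout_te_conditions : bezout_ring R ->
  [/\ bezout_ring A, domain_on_support E, locally_fp_injective E & fg_submodules_cyclic E].
Proof.
move=> bR; split; [exact: bezout_te_base | | | exact: bezout_te_fg_cyclic].
  by move=> P pP B phi N psi locB locN [n n0]; exact: localization_domain bR pP locB locN n n0.
move=> P mP B phi N psi locB locN.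
exact: localization_fp_injective bR (maximal_ideal_prime mP) locB locN.
Qed.

(** * From the conditions on [A] and [E] back to [R] *)

Section Converse.
Hypotheses (domE : domain_on_support E) (fpE : locally_fp_injective E).
Hypothesis splitA : idempotents_split_zero_products A.

(* Locally either [d] vanishes or [d] divides [f]; so [1] is the sum of some [k]
   killing [d] and some [r] with [r f] in [d E], and [k d = 0] is split by an
   idempotent. *)
Lemma divisible_or_nilpotent d f : exists c n g,
  [/\ c * c = c, c *: f = d *: g & (1 - c) * d ^+ n = 0].
Proof.
pose J := [set r | exists2 k, k * d = 0 & exists g, (r - k) *: f = d *: g].
have idJ : is_ideal J.
  split=> [|x y [k kd [g xg]] [l ld [h yh]]|r x [k kd [g xg]]].
  - by exists 0; [rewrite mul0r | exists 0; rewrite subrr scale0r scaler0].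
  - exists (k + l); first by rewrite mulrDl kd ld addr0.
    by exists (g + h); rewrite opprD addrACA scalerDl xg yh scalerDr.
  - exists (r * k); first by rewrite -mulrA kd mulr0.
    by exists (r *: g); rewrite -mulrBr -scalerA xg !scalerA mulrC.
have [P mP|k kd [g kg]] := ideal_unit_local idJ.
  have [[s Ps sd]|[s [g [Ps sg]]]] := locally_fp_injective_divides d f domE fpE mP.
    exists s => //; exists s => //; exists 0; by rewrite subrr scale0r scaler0.
  by exists s => //; exists 0; [rewrite mul0r | exists g; rewrite subr0].
have [c [n [cc ck cd]]] := splitA kd.
have [w kw] := comax_expr n (subrK k 1).
exists c, n, ((c * w) *: g); split=> //.
(* Since [c] kills [k ^+ n], the element [w] inverts [1 - k] on the part cut out by [c]. *)
have cE : c * w * (1 - k) = c.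
  transitivity (c * ((1 - k) * w + k ^+ n)); last by rewrite kw mulr1.
  by rewrite [RHS]mulrDr ck; ring.
transitivity ((c * w) *: ((1 - k) *: f)); first by rewrite scalerA cE.
by rewrite kg !scalerA; congr (_ *: _); ring.
Qed.

(* [d] vanishes locally on the support of a nilpotent [d], hence the
   annihilators of [d] and [e] are comaximal. *)
Lemma nilpotent_annihilators_comax d n e : d ^+ n = 0 ->
  exists2 k, k * d = 0 & k *: e = e.
Proof.
move=> dn; pose J := [set r | exists2 k, k * d = 0 & (r - k) *: e = 0].
have idJ : is_ideal J.
  split=> [|x y [k kd xe] [l ld ye]|r x [k kd xe]].
  - by exists 0; [rewrite mul0r | rewrite subrr scale0r].
  - exists (k + l); first by rewrite mulrDl kd ld addr0.
    by rewrite opprD addrACA scalerDl xe ye addr0.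
  - exists (r * k); first by rewrite -mulrA kd mulr0.
    by rewrite -mulrBr -scalerA xe scaler0.
have [P mP|k kd ke] := ideal_unit_local idJ; last first.
  by exists k => //; apply/esym/eqP; rewrite -subr_eq0 -{1}(scale1r e) -scalerBl ke.
have [[s Ps se]|se] := pselect (exists2 s, ~ P s & s *: e = 0).
  by exists s => //; exists 0; [rewrite mul0r | rewrite subr0].
have suppe : supports P e by move=> s Ps; apply/eqP => se0; apply: se; exists s.
have [s Ps sd] := domain_on_support_nilpotent domE (maximal_ideal_prime mP) suppe dn.
by exists s => //; exists s => //; rewrite subrr scale0r.
Qed.

(* Over a Hermite ring the ideal has generators [(d, e)] and [(0, f)]. Where
   [f] is divisible by [d], [(d, e)] generates; where [d] is nilpotent,
   [(d, g)] does, for [g] a generator of [A e + A f]. *)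
Lemma te_bezout_of_conditions : hermite_ring A -> fg_submodules_cyclic E -> bezout_ring R.
Proof.
move=> /hermite_ringP hA cycE; apply/bezout_ringP => X0 Y0.
have [d [a' [b' [u [v [aE bE uv]]]]]] := hA X0.1 Y0.1.
pose i (a : A) : R := (a, 0).
have iD a b : i (a + b) = i a + i b by rewrite /i te_addE /= addr0.
have iM a b : i (a * b) = i a * i b by rewrite /i te_mulE /= !scaler0 addr0.
(* The matrix with rows [(u, v)] and [(- b', a')] has determinant [1], so [X] and [Y] generate the
   same ideal as [X0] and [Y0], while the first coordinate of [Y] is zero. *)
pose X := i u * X0 + i v * Y0; pose Y := i a' * Y0 - i b' * X0.
have i1 : i u * i a' + i v * i b' = 1 by rewrite -!iM -iD uv.
have X0E : X0 = i a' * X - i v * Y.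
  by rewrite -[LHS]mul1r -i1 /X /Y; ring.
have Y0E : Y0 = i b' * X + i u * Y.
  by rewrite -[LHS]mul1r -i1 /X /Y; ring.
have X1 : X.1 = d.
  rewrite [LHS]/= aE bE; transitivity (d * (u * a' + v * b')); first by ring.
  by rewrite uv mulr1.
have Y1 : Y.1 = 0 by rewrite [LHS]/= aE bE; ring.
suff [G [[r XG] [s YG] [k [l GXY]]]] : exists G,
    [/\ exists r, X = G * r, exists s, Y = G * s & exists k l, G = k * X + l * Y].
  exists G, (i a' * r - i v * s), (i b' * r + i u * s).
  exists (k * i u - l * i b'), (k * i v + l * i a'); split.
  - by rewrite X0E XG YG; ring.
  - by rewrite Y0E XG YG; ring.
  - by rewrite GXY /X /Y; ring.
have [c [n [g0 [cc cf cd]]]] := divisible_or_nilpotent d Y.2.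
set e := X.2; set f := Y.2 in cf.
have [g [p [q [s [t [eg fg gE]]]]]] : exists (g : E) (p q s t : A),
    [/\ (1 - c) *: e = p *: g, (1 - c) *: f = q *: g &
        g = s *: ((1 - c) *: e) + t *: ((1 - c) *: f)].
  pose v2 (j : 'I_2) := if j == 0 then (1 - c) *: e else (1 - c) *: f.
  have [g gE] := cycE 2 v2.
  have [p ep] : cyclic_submod g ((1 - c) *: e) by rewrite -gE; exact: (fg_submod_gen v2 0).
  have [q fq] : cyclic_submod g ((1 - c) *: f) by rewrite -gE; exact: (fg_submod_gen v2 1).
  have : fg_submod v2 g by rewrite gE; exists 1; rewrite scale1r.
  case=> z zE; exists g, p, q, (z 0), (z 1); split=> //.
  by rewrite {1}zE big_ord_recr big_ord1 /=; congr (z _ *: _ + z _ *: _); apply: val_inj.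
(* The exponent is [n.+1] so that a factor [1 - c] is present even if [n = 0]. *)
have [|k kd kg] := @nilpotent_annihilators_comax ((1 - c) * d) n.+1 g.
  rewrite exprMn !exprS; transitivity ((1 - c) ^+ n * d * ((1 - c) * d ^+ n)); first by ring.
  by rewrite cd mulr0.
(* With [i] and [j] embedding [A] and [E], all relations become identities in [R], within reach of
   [ring]. *)
pose j (m : E) : R := (0, m).
have jD m m' : j (m + m') = j m + j m' by rewrite /j te_addE /= addr0.
have jZ a m : j (a *: m) = i a * j m by rewrite /j te_mulE /= mulr0 scale0r addr0.
have jj m m' : j m * j m' = 0 by rewrite /j te_mulE /= mulr0 !scale0r addr0.
have iN : i (1 - c) = 1 - i c by rewrite /i te_addE /= subr0.
have pairE z : z = i z.1 + j z.2.
  by case: z => z m; rewrite te_addE /= addr0 add0r.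
have XE : X = i d + j e by rewrite [LHS]pairE X1.
have YE : Y = j f by rewrite [LHS]pairE Y1 -[RHS]add0r.
have CC : i c * i c = i c by rewrite -iM cc.
have Cf : i c * j f = i d * j g0 by rewrite -!jZ cf.
have Ce : (1 - i c) * j e = i p * j g by rewrite -iN -!jZ eg.
have Cf' : (1 - i c) * j f = i q * j g by rewrite -iN -!jZ fg.
have gxy : j g = i s * ((1 - i c) * j e) + i t * ((1 - i c) * j f).
  by rewrite -iN -!jZ -jD -gE.
have Kd : i k * ((1 - i c) * i d) = 0 by rewrite -iN -!iM kd.
have Kg : i k * j g = j g by rewrite -jZ kg.
have CN : (1 - i c) * (1 - i c) = 1 - i c := idemN CC.
have Cg : (1 - i c) * j g = j g.
  transitivity (i s * ((1 - i c) * (1 - i c) * j e) + i t * ((1 - i c) * (1 - i c) * j f)).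
    by rewrite {1}gxy; ring.
  by rewrite CN -gxy.
(* As [g = (1 - c) g], this is [(d, e)] on the part cut out by [c] and [(d, g)] on the other.
   Multiplying by [(1 - c) k] extracts [(0, g)], since [k] kills [(1 - c) d] and fixes [g]. *)
pose G := i d + i c * j e + j g.
have gG : j g = G * ((1 - i c) * i k).
  transitivity (i k * ((1 - i c) * i d) + (i c - i c * i c) * (i k * j e) +
    i k * ((1 - i c) * j g)).
    by rewrite Kd CC Cg Kg; ring.
  by rewrite /G; ring.
exists G; split.
- exists (1 + (i p - 1) * ((1 - i c) * i k)).
  transitivity (G + (i p - 1) * (G * ((1 - i c) * i k))); last by ring.
  rewrite -gG XE; transitivity (i d + i c * j e + (1 - i c) * j e); first by ring.
  by rewrite Ce /G; ring.
- exists (j g0 + i q * ((1 - i c) * i k)).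
  transitivity (G * j g0 + i q * (G * ((1 - i c) * i k))); last by ring.
  have -> : G * j g0 = i d * j g0.
    by rewrite /G !mulrDl -mulrA !jj mulr0 !addr0.
  by rewrite -gG YE -Cf -Cf'; ring.
(* The same multiplier isolates [(0, (1 - c) e)] in [X], so [(0, g)] is a combination of [X] and
   [Y]. *)
- have KX : i k * (1 - i c) * X = (1 - i c) * j e.
    transitivity (i k * ((1 - i c) * i d) + i k * ((1 - i c) * j e)); first by rewrite XE; ring.
    by rewrite Kd Ce mulrCA Kg add0r.
  exists (1 - i k * (1 - i c) + i s * (i k * (1 - i c))), (i t * (1 - i c)).
  transitivity (X - i k * (1 - i c) * X +
    (i s * (i k * (1 - i c) * X) + i t * ((1 - i c) * Y))); last by ring.
  by rewrite KX YE -gxy XE /G; ring.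
Qed.
End Converse.
End TrivialExtension.

Theorem theorem3p2 (A : comNzRingType) (E : lmodType A)
    (E_nonzero : exists e : E, e != 0)
    (pSpec_td : totally_disconnected [set: pSpec A]) :
  [<-> hermite_ring (triv_ext E);
       bezout_ring (triv_ext E);
       [/\ bezout_ring A, domain_on_support E,
           locally_fp_injective E & fg_submodules_cyclic E]].
Proof.
tfae.
- exact: hermite_bezout.
- exact: bezout_te_conditions.
- move=> [bA domE fpE cycE]; have splitA := bezout_idempotents_split bA pSpec_td.
  apply: bezout_split_hermite; last exact: te_idempotents_split.
  exact: te_bezout_of_conditions domE fpE splitA (bezout_split_hermite bA splitA) cycE.
Qed.
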